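(* Let $\kappa$ be any cardinal. There exists a weakly Lindelöf determined Banach space $X$ such that $CG(X)>\kappa$.
   Context: For a topological space $Z$, the index of compact generation $CG(Z)$ is the least infinite cardinal $\kappa$ such that there exists a family $\{K_\lambda:\lambda<\kappa\}$ of compact subsets of $Z$ whose union is dense in $Z$. For a Banach space $X$, $CG(X)$ is always computed with respect to the weak topology of $X$. A Banach space $X$ is weakly Lindelöf determined if its dual unit ball $B_{X^*}$ with the weak$^*$ topology is a Corson compact, i.e. is homeomorphic to a compact subset $K\subset\mathbb{R}^\Gamma$ for some set $\Gamma$ such that for every $x\in K$ the set $\{\gamma\in\Gamma: x_\gamma\neq 0\}$ is countable. *)

(* Defs.v *)
From HB Require Import structures.
From mathcomp Require Import all_boot all_order all_algebra.
From mathcomp Require Import all_classical all_reals all_analysis.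

Set Implicit Arguments.
Unset Strict Implicit.
Unset Printing Implicit Defensive.

Import Order.TTheory GRing.Theory Num.Theory.
Import numFieldNormedType.Exports.

Local Open Scope classical_set_scope.
Local Open Scope card_scope.
Local Open Scope ring_scope.

(* Cardinals are represented by types (or sets), compared by injections: the
   library has card_le, but no type of cardinals and no strict comparison. *)
Definition card_lt (T U : Type) (A : set T) (B : set U) : Prop :=
  A #<= B /\ ~ (B #<= A).

Section CompactGeneration.
Variable Z : topologicalType.

Definition compactly_generated_by (C : Type) : Prop :=
  exists K : C -> set Z,
    (forall c, compact (K c)) /\ dense (\bigcup_(c in [set: C]) K c).

(* CG is a relation: [is_CG C] says that the cardinality of [C] is CG(Z), which
   determines [C] up to bijection. *)
Definition is_CG (C : Type) : Prop :=
  [/\ infinite_set [set: C],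
      compactly_generated_by C &
      forall D : Type, infinite_set [set: D] -> compactly_generated_by D ->
        [set: C] #<= [set: D]].

End CompactGeneration.

Definition homeomorphic (S T : topologicalType) : Prop :=
  exists (f : S -> T) (g : T -> S),
    [/\ cancel f g, cancel g f, continuous f & continuous g].

(* [set_type K] carries the topology induced by the product space R^Gamma. *)
Definition corson_compact (R : realType) (T : topologicalType) : Prop :=
  exists (Gamma : Type) (K : set {ptws Gamma -> R}),
    [/\ compact K,
        forall x, K x -> countable [set g : Gamma | x g != 0] &
        homeomorphic T (set_type K)].

Section Dual.
Variables (R : realType) (X : normedModType R).

Record dual : Type := Dual {
  dual_fun :> {linear X -> R^o};
  dual_continuous : continuous dual_fun }.

HB.instance Definition _ := gen_eqMixin dual.
HB.instance Definition _ := gen_choiceMixin dual.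

Definition dual_norm (f : dual) : R :=
  sup [set `|(f x : R)| | x in [set x : X | `|x| <= 1]].

(* The weak topology: the coarsest one making every element of the dual
   continuous, as the initial topology of the evaluation map X -> R^(X^* ). *)
Definition weak_eval (x : X) : {ptws dual -> R} := fun f => f x.
Definition weak_space : Type := initial_topology weak_eval.
HB.instance Definition _ := Topological.on weak_space.

(* The weak^* topology: pointwise convergence on X. *)
Definition weak_star_eval (f : dual) : {ptws X -> R} := fun x => f x.
Definition weak_star_dual : Type := initial_topology weak_star_eval.
HB.instance Definition _ := Topological.on weak_star_dual.

Definition dual_ball : set weak_star_dual :=
  [set f : weak_star_dual | dual_norm f <= 1].

Definition weakly_Lindelof_determined : Prop :=
  corson_compact R (set_type dual_ball).

End Dual.

(* Main.v *)
Require Import Defs.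
From HB Require Import structures.
From mathcomp Require Import all_boot all_order all_algebra.
From mathcomp Require Import all_classical all_reals all_analysis.
From mathcomp Require Import zify lra.

(** Let [A] be the power set of [kappa], let [T] be the set of sequences [nat -> A],
    seen as the branches of a tree, and call a finite set of branches a comb if
    its elements leave some branch [s] at pairwise distinct levels. The space is
    the completion [comb_space] of the finitely supported real functions on [T]
    for the norm
      [|x| = sup { sum of |x g| for g in l : l a comb }].

    It cannot be generated by [kappa] weakly compact sets. Suppose that these sets
    have a weakly dense union. Each basis vector [basis g] is weakly approximated
    from one of them, so each [g] in [T] gets the index of a compact set containing
    a vector whose coordinate at [g] is at least [1/2]. Since [kappa] does not map
    onto [A], a diagonal argument ([monochromatic_comb]) finds an infinite comb all
    of whose elements have the same index. On an infinite comb the norm dominates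
    that of [l^1], and a gliding hump, as in the proof that weakly compact subsets
    of [l^1] are norm compact, shows that a weakly compact set cannot contain such
    vectors for all the elements of the comb ([weakly_compact_comb_seq]).

    The space is weakly Lindelof determined because every functional has countable
    support on the basis vectors ([dual_support_countable]); evaluation on the
    basis then embeds the dual ball, compact by Alaoglu's theorem, in a product of
    lines, with countably supported image ([comb_space_wld]). The support is
    countable by the following combinatorial fact ([comb_rich_countable]): if the
    functional were bounded away from zero on uncountably many basis vectors, then
    a fixed proportion of any finite subset of the corresponding branches would lie
    in a single comb; but an uncountable set of branches contains either arbitrarily
    many branches that are pairwise distinct below a fixed level [n], or the [2 ^ m]
    leaves of a binary tree for every [m], and a comb contains at most [n + 1] of
    the former and at most [m + 1] of the latter.

    It remains to see that the index of compact generation exists, as the relation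
    [is_CG] requires a least cardinal: [is_CG_exists], from the well-foundedness of
    cardinals. *)

Set Implicit Arguments.
Unset Strict Implicit.
Unset Printing Implicit Defensive.

Import Order.TTheory GRing.Theory Num.Theory.
Import numFieldNormedType.Exports.

Local Open Scope classical_set_scope.
Local Open Scope card_scope.
Local Open Scope ring_scope.

(** * Cardinals and the index of compact generation *)

Lemma card_leTP (T U : Type) :
  [set: T] #<= [set: U] <-> exists f : T -> U, injective f.
Proof.
split=> [/card_leP[f]|[f finj]]; last first.
  have /injfunPex[g] : exists2 f : T -> U,
    set_fun [set: T] [set: U] f & set_inj [set: T] f.
    by exists f => // x y _ _; exact: finj.
  exact: inj_card_le.
have fI : injective f by move=> x y; apply: 'inj_f; rewrite inE.
exists (fun x => val (f (SigSub (mem_setT x)))) => x y /val_inj/fI.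
by case.
Qed.

(** Cardinals are well-founded. A set of points of the product of the [T i] on
    which every projection is injective, maximal for this property, projects
    onto some [T i]: otherwise a point missed in every coordinate could be added
    to it. That [T i] is then in bijection with the set, which injects into
    every [T j]. *)
Lemma least_cardinal (I : Type) (i0 : I) (T : I -> Type) :
  exists i, forall j, [set: T i] #<= [set: T j].
Proof.
pose P (Z : set (forall i, T i)) :=
  forall i z z', Z z -> Z z' -> z i = z' i -> z = z'.
have [F FP Ftot|Z [PZ Zmax]] := @Zorn_bigcup _ P.
  move=> i z z' [A FA Az] [B FB Bz'].
  have [AB|BA] := Ftot _ _ FA FB.
    exact: (FP _ FB i _ _ (AB _ Az)).
  exact: (FP _ FA i _ _ Az (BA _ Bz')).
have [i Zi] : exists i, forall t : T i, exists2 z, Z z & z i = t.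
  apply: contrapT => noi.
  have miss i : exists t : T i, forall z, Z z -> z i <> t.
    apply: contrapT => noti; apply: noi; exists i => t.
    apply: contrapT => notz; apply: noti; exists t => z Zz zt.
    by apply: notz; exists z.
  pose w i := sval (cid (miss i)).
  have wZ i z : Z z -> z i <> w i by exact: (svalP (cid (miss i))).
  apply: (Zmax (Z `|` [set w])).
    by split=> [z Zz|]; [left|move=> /(_ w (or_intror erefl))/(wZ i0)].
  move=> i z z' [Zz|->] [Zz'|->] //; first exact: PZ.
    by move/wZ.
  by move/esym/wZ.
exists i => j; apply/card_leTP.
pose f t := s2val (cid2 (Zi t)).
exists (fun t => f t j) => t t' /PZ fE.
rewrite -(s2valP' (cid2 (Zi t))) -(s2valP' (cid2 (Zi t'))).
rewrite -/(f t) -/(f t') fE //; first exact: (s2valP (cid2 (Zi t))).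
exact: (s2valP (cid2 (Zi t'))).
Qed.

Lemma card_le_total (T U : Type) :
  [set: T] #<= [set: U] \/ [set: U] #<= [set: T].
Proof.
have [[] le] := @least_cardinal bool true (fun b => if b then T else U).
  by left; exact: (le false).
by right; exact: (le true).
Qed.

Section CompactGenerationIndex.
Variable Z : topologicalType.

Lemma compactly_generated_by_inj (C D : Type) :
  [set: C] #<= [set: D] -> compactly_generated_by Z C ->
  compactly_generated_by Z D.
Proof.
move=> /card_leTP[f finj] [K [Kc Kd]].
exists (fun d => \bigcup_(c in [set c | f c = d]) K c); split=> [d|].
  have [[c cd]|nd] := pselect (exists c, f c = d).
    rewrite (_ : bigcup _ _ = K c) //; apply/seteqP; split=> [x [c' c'd Kx]|x Kx].
      by rewrite (finj c c') // cd c'd.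
    by exists c.
  rewrite (_ : bigcup _ _ = set0); first exact: compact0.
  by rewrite -subset0 => x [c cd _]; apply: nd; exists c.
rewrite (_ : bigcup _ _ = \bigcup_(c in [set: C]) K c) //.
apply/seteqP; split=> [x [d _ [c _ Kx]]|x [c _ Kx]]; first by exists c.
by exists (f c) => //; exists c.
Qed.

(** The singletons generate [Z], so [nat + Z] is an infinite index type that
    works, and any other one is either at least as large or in bijection with a
    subset of [nat + Z]. It is therefore enough to minimise over the subsets of
    this one type, where [least_cardinal] applies. *)
Lemma is_CG_exists : exists C : Type, is_CG Z C.
Proof.
pose C0 : Type := (nat + Z)%type.
pose good (S : set C0) := infinite_set [set: set_type S] /\
  compactly_generated_by Z (set_type S).
have C0inf : infinite_set [set: C0].
  by apply/infiniteP/card_leTP; exists inl => ? ? [].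
have C0gen : compactly_generated_by Z C0.
  exists (fun c => if c is inr x then [set x] else set0); split.
    by case=> [n|x]; [exact: compact0|exact: compact_set1].
  move=> U [x Ux] _; exists x; split=> //.
  by exists (inr x).
have goodP D : infinite_set [set: D] -> compactly_generated_by Z D ->
    [set: D] #<= [set: C0] ->
    exists2 S, good S & [set: set_type S] #<= [set: D].
  move=> Dinf Dgen /card_leTP[f finj].
  have DS : [set: D] #<= [set: set_type (range f)].
    apply/card_leTP.
    exists (fun d => SigSub (mem_set (imageP f (I : setT d))) : set_type (range f)).
    by move=> d d' [] /finj.
  exists (range f); first split.
  - by move: Dinf; rewrite !infiniteP => /card_le_trans; exact.
  - exact: compactly_generated_by_inj DS Dgen.
  - have get (s : set_type (range f)) : exists d, f d = val s.
      by have [d _ <-] := set_mem (valP s); exists d.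
    apply/card_leTP; exists (fun s => sval (cid (get s))) => s s' ss'.
    apply: val_inj; rewrite -(svalP (cid (get s))) -(svalP (cid (get s'))).
    by rewrite ss'.
have [S0 gS0 _] := goodP _ C0inf C0gen (card_lexx _).
have [[S [Sinf Sgen]] /= Sle] := @least_cardinal {S | good S} (exist _ S0 gS0)
  (fun S => set_type (sval S)).
exists (set_type S); split=> // D Dinf Dgen.
have SD D' : infinite_set [set: D'] -> compactly_generated_by Z D' ->
    [set: D'] #<= [set: C0] -> [set: set_type S] #<= [set: D'].
  move=> D'inf D'gen /(goodP _ D'inf D'gen)[S' gS'].
  exact: card_le_trans (Sle (exist _ S' gS')).
have [/SD|C0D] := card_le_total D C0; first exact.
exact: card_le_trans (SD _ C0inf C0gen (card_lexx _)) C0D.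
Qed.

End CompactGenerationIndex.

(** * Combs of branches *)

Section Combs.
Variable A : choiceType.
Implicit Types (f g s : nat -> A) (l F : seq (nat -> A)) (G H : set (nat -> A)).

Definition agree n f g := forall k, (k < n)%N -> f k = g k.

Definition splits s n f := agree n f s /\ f n <> s n.

(** Every element of a comb hangs from the branch [s] at a level of its own;
    [s] itself may also be an element, as it never leaves. *)
Definition comb l := uniq l /\
  exists s, forall n, {in l &, forall f g, splits s n f -> splits s n g -> f = g}.

Lemma agree_sym n f g : agree n f g -> agree n g f.
Proof. by move=> fg k kn; rewrite fg. Qed.

Lemma agree_trans n f g s : agree n f g -> agree n g s -> agree n f s.
Proof. by move=> fg gs k kn; rewrite fg// gs. Qed.

Lemma splits_inj s m n f : splits s m f -> splits s n f -> m = n.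
Proof.
move=> [fm fmN] [fn fnN]; apply/eqP; rewrite eqn_leq; apply/andP.
by split; rewrite leqNgt; apply/negP; [move/fm|move/fn].
Qed.

Lemma agree_or_splits s n f :
  agree n f s \/ exists2 k, (k < n)%N & splits s k f.
Proof.
elim: n => [|n [IH|[k kn ks]]]; first by left.
  have [e|e] := pselect (f n = s n); last by right; exists n.
  left=> k; rewrite ltnS leq_eqVlt => /predU1P[->//|]; exact: IH.
by right; exists k => //; exact: ltnW.
Qed.

Lemma comb_sub l l' : uniq l' -> {subset l' <= l} -> comb l -> comb l'.
Proof.
move=> u sub [_ [s sP]]; split=> //; exists s => n f g fl gl.
by apply: sP; exact: sub.
Qed.

Lemma comb1 f : comb [:: f].
Proof. by split=> //; exists f => n g h; rewrite !inE => -> ->. Qed.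

(** Sending [f] to the level below [n] at which it leaves [s], or to [n] if
    there is none, is injective: two elements that both agree with [s] below
    [n] agree with each other. *)
Lemma comb_separated_size n l : comb l ->
  {in l &, forall f g, agree n f g -> f = g} -> (size l <= n.+1)%N.
Proof.
move=> [u [s sP]] sep.
pose lev f := find (fun k => f k != s k) (iota 0 n).
have levn f : (lev f <= n)%N by rewrite -[leqRHS](size_iota 0) find_size.
have before f k : (k < lev f)%N -> f k = s k.
  move=> kf; have kn : (k < n)%N by exact: leq_trans kf (levn f).
  have /negbT := before_find 0%N kf.
  by rewrite nth_iota// add0n negbK => /eqP.
have levP f : (lev f < n)%N -> splits s (lev f) f.
  move=> fn; split; first exact: before.
  have : has (fun k => f k != s k) (iota 0 n) by rewrite has_find size_iota.
  by move=> /(nth_find 0%N); rewrite nth_iota// add0n => /eqP.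
have levI : {in l &, injective lev}.
  move=> f g fl gl fg; have [fn|fn] := ltnP (lev f) n.
    by apply: (sP (lev f)) => //; [exact: levP|rewrite fg; apply: levP; rewrite -fg].
  apply: sep => //; apply: (@agree_trans _ _ s) => [k kn|].
    by apply: before; exact: leq_trans kn fn.
  apply: agree_sym => k kn; apply: before; rewrite -fg; exact: leq_trans kn fn.
rewrite -(size_map lev) -[n.+1](size_iota 0); apply: uniq_leq_size.
  by rewrite map_inj_in_uniq.
by move=> _ /mapP[f _ ->]; rewrite mem_iota add0n ltnS levn.
Qed.

(** A fixed proportion of any finite subset of [G] can be found in a single comb.
    The coordinates at which a functional exceeds a given positive bound form
    such a set. *)
Definition comb_rich q G := forall F, uniq F -> {subset F <= G} ->
  exists l, [/\ comb l, {subset l <= F} & (size F <= q * size l)%N].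

Lemma comb_rich_sub q G H : H `<=` G -> comb_rich q G -> comb_rich q H.
Proof.
by move=> HG Gq F u FH; apply: Gq => // f /FH; rewrite !inE; exact: HG.
Qed.

(** Elements pairwise distinct below [n] contain no comb of more than [n.+1]
    elements, so at most [q * n.+1] of them fit in [G]; a largest such family
    meets every cylinder of level [n] that [G] meets. *)
Lemma comb_rich_cylinders q G n : comb_rich q G ->
  exists2 r : seq (nat -> A), {subset r <= G} &
    forall f, G f -> exists2 g, g \in r & agree n f g.
Proof.
move=> Gq; pose P m := `[< exists r, [/\ size r = m, uniq r, {subset r <= G} &
  {in r &, forall f g, agree n f g -> f = g}] >].
have P0 : exists m, P m by exists 0%N; apply/asboolP; exists [::].
have Pub m : P m -> (m <= q * n.+1)%N.
  move=> /asboolP[r [<- u rG sep]]; have [l [cl lr /leq_trans]] := Gq _ u rG.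
  apply; rewrite leq_mul2l (@comb_separated_size n) ?orbT// => f g /lr fr /lr gr.
  exact: sep.
have [m /asboolP[r [rm u rG sep]] mmax] := ex_maxnP P0 Pub.
exists r => // f Gf; apply: contrapT => nof.
have far g : g \in r -> ~ agree n f g by move=> gr fg; apply: nof; exists g.
suff /mmax : P m.+1 by rewrite ltnn.
apply/asboolP; exists (f :: r); split=> [|||g h] /=.
- by rewrite rm.
- by rewrite u andbT; apply/negP => /far; exact.
- by move=> g; rewrite !inE => /predU1P[->|/rG] //; rewrite inE.
rewrite !inE => /predU1P[->|gr] /predU1P[->|hr] //.
- by move/far => /(_ hr).
- by move/agree_sym/far => /(_ gr).
exact: sep.
Qed.

(** By [comb_rich_cylinders] only countably many cylinders meet [G]. Hence the
    elements of [G] that have some cylinder meeting [G] in a countable set are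
    countably many, and any two of the others give the required pair. *)
Lemma comb_rich_split q G : comb_rich q G -> ~ countable G ->
  exists n f g, [/\ ~ agree n f g, ~ countable (G `&` agree n f) &
    ~ countable (G `&` agree n g)].
Proof.
move=> Gq Gunc.
pose D n := [set f | G f /\ countable (G `&` agree n f)].
have Dc n : countable (D n).
  have [r rG rcov] := comb_rich_cylinders n Gq.
  apply: (@sub_countable _ _ _ (\bigcup_(g in [set g | g \in r /\
    countable (G `&` agree n g)]) (G `&` agree n g))); last first.
    apply: bigcup_countable => [|g []//].
    apply: finite_set_countable; apply: (@sub_finite_set _ _ [set` r]).
      by move=> g [].
    exact: finite_seq.
  apply: subset_card_le => f [Gf fc]; have [g gr fg] := rcov f Gf.
  exists g; last by split=> //; exact: agree_sym.
  split=> //; apply: sub_countable fc; apply: subset_card_le => h [Gh gh].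
  by split=> //; exact: agree_trans fg gh.
have Uunc : ~ countable (G `\` \bigcup_n D n).
  move=> Uc; apply: Gunc.
  have -> : G = (G `\` \bigcup_n D n) `|` (G `&` \bigcup_n D n).
    by rewrite setUC setUIDK.
  rewrite -bigcup2E; apply: bigcup_countable => // -[|[|i]] _ //=.
    apply: (@sub_countable _ _ _ (\bigcup_n D n)).
      by apply: subset_card_le => f [].
    exact: bigcup_countable.
have unc n f : (G `\` \bigcup_n D n) f -> ~ countable (G `&` agree n f).
  by move=> [Gf fD] fc; apply: fD; exists n.
have [f Uf] : (G `\` \bigcup_n D n) !=set0.
  by apply/set0P/eqP => U0; apply: Uunc; rewrite U0.
have [g Ug gf] : exists2 g, (G `\` \bigcup_n D n) g & g <> f.
  apply: contrapT => no; apply: Uunc; apply: (@sub_countable _ _ _ [set f]) => //.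
  apply: subset_card_le => g Ug; apply: contrapT => gf; apply: no.
  by exists g.
have [k fgk] : exists k, f k <> g k.
  apply: contrapT => no; apply: gf; apply/funext => k; apply: contrapT => gf.
  by apply: no; exists k => e; apply: gf.
exists k.+1, f, g; split; [|exact: unc..].
by move/(_ k (leqnn _)).
Qed.

(** Iterated splitting yields a binary tree with [2 ^ m] leaves. At each
    splitting the branch [s] of a comb follows at most one side, and all elements
    of the other side leave [s] at the same level, so that side contributes at
    most one element to the comb. *)
Lemma comb_rich_bush q G m : comb_rich q G -> ~ countable G ->
  exists F, [/\ uniq F, {subset F <= G}, size F = (2 ^ m)%N &
    forall l, comb l -> {subset l <= F} -> (size l <= m.+1)%N].
Proof.
elim: m G => [|m IH] G Gq Gunc.
  have [f Gf] : G !=set0 by apply/set0P/eqP => G0; apply: Gunc; rewrite G0.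
  exists [:: f]; split=> //; first by move=> g; rewrite !inE => ->.
  by move=> l [u _] lf; exact: (@uniq_leq_size _ _ [:: f]).
have [n [f [g [fg fU gU]]]] := comb_rich_split Gq Gunc.
have half h : ~ countable (G `&` agree n h) -> exists F,
    [/\ uniq F, {subset F <= G `&` agree n h}, size F = (2 ^ m)%N &
    forall l, comb l -> {subset l <= F} -> (size l <= m.+1)%N].
  by apply: IH; apply: comb_rich_sub Gq => ? [].
have [F1 [u1 F1G s1 c1]] := half _ fU.
have [F2 [u2 F2G s2 c2]] := half _ gU.
exists (F1 ++ F2); split.
- rewrite cat_uniq u1 u2 andbT; apply/hasPn => h /F2G; rewrite inE => -[_ gh].
  apply/negP => /F1G; rewrite inE => -[_ fh]; apply: fg.
  exact: agree_trans fh (agree_sym gh).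
- by move=> h; rewrite mem_cat => /orP[/F1G|/F2G]; rewrite !inE => -[].
- by rewrite size_cat s1 s2 addnn -mul2n expnS.
move=> l cl lF; have [u [s sP]] := cl.
have off h F : ~ agree n h s -> {subset F <= G `&` agree n h} ->
    (size [seq x <- l | x \in F] <= 1)%N.
  move=> hs FG.
  have key x y : x \in [seq x <- l | x \in F] ->
      y \in [seq x <- l | x \in F] -> x = y.
    rewrite !mem_filter => /andP[xF xl] /andP[yF yl].
    have := FG _ xF; have := FG _ yF; rewrite !inE => -[_ hy] [_ hx].
    have [xs|[k kn xk]] := agree_or_splits s n x.
      by case: hs; exact: agree_trans hx xs.
    have yx : agree n y x by exact: agree_trans (agree_sym hy) hx.
    case: (xk) => xs xsN; apply: (sP k) => //; split=> [j jk|].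
      by rewrite yx ?xs// (ltn_trans jk).
    by rewrite yx.
  have := filter_uniq (fun x => x \in F) u; move: key.
  by case: [seq x <- l | _] => [//|x [//|y t]] key /=;
    rewrite (key x y) ?inE ?eqxx ?orbT.
have inner F c : (forall l, comb l -> {subset l <= F} -> (size l <= c)%N) ->
    (size [seq x <- l | x \in F] <= c)%N.
  apply; last by move=> x; rewrite mem_filter => /andP[].
  apply: comb_sub cl; first exact: filter_uniq.
  by move=> x; rewrite mem_filter => /andP[].
have le : (size l <= size ([seq x <- l | x \in F1] ++ [seq x <- l | x \in F2]))%N.
  apply: uniq_leq_size => // x xl; rewrite mem_cat !mem_filter xl !andbT.
  by rewrite -mem_cat lF.
apply: leq_trans le _; rewrite size_cat.
have [fs|fs] := pselect (agree n f s).
  rewrite -addn1 leq_add ?(inner F1)// (off g)// => gs.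
  by apply: fg; exact: agree_trans fs (agree_sym gs).
by rewrite -add1n leq_add ?(off f F1)// (inner F2).
Qed.

(** In an uncountable [G] the bushes would give [2 ^ m <= q * m.+1] for all [m]. *)
Lemma comb_rich_countable q G : comb_rich q G -> countable G.
Proof.
move=> Gq; apply: contrapT => Gunc.
(* [2 ^ (4 * q) >= (2 * q + 1) ^ 2 > q * (4 * q + 1)]. *)
pose p := (2 * q)%N.
have [F [u FG sF cF]] := comb_rich_bush (p + p) Gq Gunc.
have [l [cl lF]] := Gq F u FG.
apply/negP; rewrite -ltnNge sF expnD.
have le2 : (q * size l <= q * (p + p).+1)%N by rewrite leq_mul2l cF ?orbT.
apply: (leq_ltn_trans le2).
have lep : (p.+1 * p.+1 <= 2 ^ p * 2 ^ p)%N by rewrite leq_mul// ltn_expl.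
apply: leq_trans lep; rewrite /p; nia.
Qed.

(** A diagonal argument. For every node and every colour fix an element of that
    colour extending the node, if there is one, and build a branch [s] that at
    each node avoids all the values taken there by the chosen elements; this is
    possible since no map from the colours to [A] is onto. For the colour of [s]
    there is a choice at every node of [s], witnessed by [s] itself, and the
    element chosen at level [n] leaves [s] exactly at level [n]. *)
Lemma monochromatic_comb (I : Type) (c : (nat -> A) -> I) (z : A) :
  (forall h : I -> A, exists a, forall i, h i <> a) ->
  exists (i : I) (d : nat -> nat -> A), [/\ injective d,
    forall n, c (d n) = i & forall l : seq nat, uniq l -> comb (map d l)].
Proof.
move=> diag.
pose pick i n g := if pselect (exists h, agree n h g /\ c h = i) is left e
  then sval (cid e) else g.
have pickP i n g h : agree n h g -> c h = i ->
    agree n (pick i n g) g /\ c (pick i n g) = i.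
  move=> hg ci; rewrite /pick; case: pselect => [e|[]]; last by exists h.
  exact: (svalP (cid e)).
have /choice[a aP] : forall ng : nat * (nat -> A),
    exists a, forall i, pick i ng.1 ng.2 ng.1 <> a.
  by move=> [n g]; exact: (diag (fun i => pick i n g n)).
pose step n g k := if k == n then a (n, g) else g k.
pose b := fix b n : nat -> A := if n is m.+1 then step m (b m) else fun=> z.
pose s n := b n.+1 n.
have bs n : agree n (b n) s.
  elim: n => [//|n IH] k; rewrite ltnS leq_eqVlt => /predU1P[->//|kn].
  by rewrite /= /step ltn_eqF// IH.
pose d n := pick (c s) n (b n).
have dP n : agree n (d n) (b n) /\ c (d n) = c s.
  by apply: pickP (erefl _); apply: agree_sym; exact: bs.
have ds n : splits s n (d n).
  split; first by apply: agree_trans (bs n); case: (dP n).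
  by rewrite /s /= /step eqxx; exact: (aP (n, b n)).
have dinj : injective d.
  by move=> m n mn; apply: (@splits_inj s _ _ (d m)) => //; rewrite mn.
exists (c s), d; split=> [//|n|l u]; first by case: (dP n).
split; first by rewrite map_inj_uniq.
exists s => n f g /mapP[i _ ->] /mapP[j _ ->] si sj.
by rewrite -(splits_inj si (ds i)) -(splits_inj sj (ds j)).
Qed.

End Combs.

(** * The space of the comb norm *)

Lemma ler_sum_uniq (R : numDomainType) (T : eqType) (s s' : seq T) (x : T -> R) :
  (forall i, 0 <= x i) -> uniq s -> uniq s' -> {subset s <= s'} ->
  \sum_(i <- s) x i <= \sum_(i <- s') x i.
Proof.
move=> x0 u u' ss'; rewrite [leRHS](bigID (mem s))/= -[X in X + _]big_filter.
have /(perm_big _)-> : perm_eq s [seq i <- s' | i \in s]; last first.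
  by rewrite lerDl sumr_ge0.
apply: uniq_perm; rewrite ?filter_uniq// => i.
by rewrite mem_filter; apply/idP/andP => [si|[]//]; rewrite si ss'.
Qed.

Lemma cvg_sum_seq (R : numFieldType) (U I : Type) (F : set_system U)
    {FF : Filter F} (l : seq I) (f : I -> U -> R) (a : I -> R) :
  (forall i, f i u @[u --> F] --> a i) ->
  \sum_(i <- l) f i u @[u --> F] --> \sum_(i <- l) a i.
Proof.
move=> fa; elim: l => [|i l IH].
  by rewrite big_nil; under eq_fun do rewrite big_nil; exact: cvg_cst.
by rewrite big_cons; under eq_fun do rewrite big_cons; exact: cvgD.
Qed.

Section CombSpace.
Variables (R : realType) (A : choiceType).
Local Notation T := (nat -> A).
Implicit Types (x y : T -> R^o) (l F : seq T) (e : R).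

(** The part of [x] outside the finite set [F] has norm at most [e]. *)
Definition small_off F e x :=
  forall l, comb l -> \sum_(g <- l | g \notin F) `|x g| <= e.

(** These are the limits of finitely supported functions for the comb norm, that
    is, the completion of the space of finitely supported functions. *)
Definition comb_null : {pred (T -> R^o)} :=
  fun x => `[< forall e, 0 < e -> exists F, small_off F e x >].

Lemma comb_nullP x :
  reflect (forall e, 0 < e -> exists F, small_off F e x) (x \in comb_null).
Proof. exact: asboolP. Qed.

Lemma small_off_sub F F' e x : {subset F <= F'} -> small_off F e x ->
  small_off F' e x.
Proof.
move=> FF' xF l /xF; apply: le_trans.
rewrite big_mkcond [leRHS]big_mkcond ler_sum// => g _.
by case: (boolP (g \notin F')) => [/(contra (FF' g))->|]//=; case: ifP.
Qed.

Lemma comb_null_submod : submod_closed comb_null.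
Proof.
split=> [|a x y /comb_nullP xP /comb_nullP yP]; apply/comb_nullP => e e0.
  by exists [::] => l _; rewrite big1 ?ltW// => g _; rewrite normr0.
have e2 : 0 < e / 2 by rewrite divr_gt0.
have a0 : 0 < `|a| + 1 by rewrite ltr_wpDl.
have [F1 xF] := xP (e / 2 / (`|a| + 1)) (divr_gt0 e2 a0).
have [F2 yF] := yP _ e2.
exists (F1 ++ F2) => l cl.
apply: (@le_trans _ _ (\sum_(g <- l | g \notin F1 ++ F2) (`|a| * `|x g| + `|y g|))).
  by apply: ler_sum => g _; rewrite (le_trans (ler_normD _ _))// normrM.
rewrite big_split -mulr_sumr [leRHS]splitr lerD//=; last first.
  by apply: (small_off_sub _ yF cl) => g gF; rewrite mem_cat gF orbT.
have x12 : \sum_(g <- l | g \notin F1 ++ F2) `|x g| <= e / 2 / (`|a| + 1).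
  by apply: (small_off_sub _ xF cl) => g gF; rewrite mem_cat gF.
move: x12; rewrite ler_pdivlMr// mulrC; apply: le_trans.
by rewrite ler_wpM2r ?lerDl ?sumr_ge0.
Qed.

HB.instance Definition _ := GRing.isSubmodClosed.Build R (T -> R^o) comb_null
  comb_null_submod.

Record comb_space := CombSpace { coef :> T -> R^o; coefP : coef \in comb_null }.

HB.instance Definition _ := [isSub for coef].
HB.instance Definition _ := [Choice of comb_space by <:].
HB.instance Definition _ := [SubChoice_isSubLmodule of comb_space by <:].

Implicit Types (u v w : comb_space).

Definition comb_sums x := [set \sum_(g <- l) `|x g| | l in [set l | comb l]].

Definition comb_norm u : R := sup (comb_sums u).

(** Outside a finite set the sums are at most [1], and on it they are bounded by
    the total sum, as combs have no repetition. *)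
Lemma comb_sums_ubound u : has_ubound (comb_sums u).
Proof.
have /comb_nullP/(_ _ ltr01)[F uF] := coefP u.
exists (\sum_(g <- undup F) `|u g| + 1) => _ [l cl <-].
rewrite (bigID (mem F))/= lerD//; last exact: uF.
rewrite -big_filter ler_sum_uniq ?undup_uniq ?filter_uniq//; first by case: cl.
by move=> g; rewrite mem_filter mem_undup => /andP[].
Qed.

Lemma comb_sum_le u l : comb l -> \sum_(g <- l) `|u g| <= comb_norm u.
Proof. by move=> cl; apply: ub_le_sup; [exact: comb_sums_ubound|exists l]. Qed.

(** The bound [e] has to be nonnegative because of the case of an empty type [A],
    where there are no combs and the norm is the supremum of the empty set. *)
Lemma comb_norm_le u e : 0 <= e ->
  (forall l, comb l -> \sum_(g <- l) `|u g| <= e) -> comb_norm u <= e.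
Proof.
move=> e0 ue; rewrite /comb_norm; have [->|/set0P ne] := eqVneq (comb_sums u) set0.
  by rewrite sup0.
by apply: ge_sup => // _ [l cl <-]; exact: ue.
Qed.

Lemma comb_norm_ge0 u : 0 <= comb_norm u.
Proof.
rewrite /comb_norm; have [->|/set0P[_ [l cl _]]] := eqVneq (comb_sums u) set0.
  by rewrite sup0.
by apply: le_trans (comb_sum_le u cl); exact: sumr_ge0.
Qed.

Lemma coef_le u g : `|u g| <= comb_norm u.
Proof. by have := comb_sum_le u (comb1 g); rewrite big_seq1. Qed.

Lemma coefD u v g : (u + v) g = u g + v g. Proof. by []. Qed.
Lemma coefB u v g : (u - v) g = u g - v g. Proof. by []. Qed.
Lemma coefZ a u g : (a *: u) g = a * u g. Proof. by []. Qed.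

Lemma comb_normD u v : comb_norm (u + v) <= comb_norm u + comb_norm v.
Proof.
apply: comb_norm_le => [|l cl]; first by rewrite addr_ge0 ?comb_norm_ge0.
apply: le_trans (lerD (comb_sum_le u cl) (comb_sum_le v cl)).
by rewrite -big_split ler_sum// => g _; rewrite coefD ler_normD.
Qed.

Lemma comb_normZ a u : comb_norm (a *: u) = `|a| * comb_norm u.
Proof.
have le b w : comb_norm (b *: w) <= `|b| * comb_norm w.
  apply: comb_norm_le => [|l cl]; first by rewrite mulr_ge0 ?comb_norm_ge0.
  under eq_bigr do rewrite coefZ normrM.
  by rewrite -mulr_sumr ler_wpM2l// comb_sum_le.
apply/eqP; rewrite eq_le le /=; have [->|a0] := eqVneq a 0.
  by rewrite normr0 mul0r comb_norm_ge0.
have := le a^-1 (a *: u); rewrite scalerA mulVf// scale1r normfV.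
by rewrite mulrC ler_pdivlMr ?normr_gt0// mulrC.
Qed.

Lemma comb_norm0_eq0 u : comb_norm u = 0 -> u = 0.
Proof.
move=> u0; apply: val_inj; apply/funext => g /=.
by apply/normr0_eq0/le_anti; rewrite normr_ge0 -u0 coef_le.
Qed.

HB.instance Definition _ := Lmodule_isNormed.Build R comb_space
  comb_normD comb_normZ comb_norm0_eq0.

Lemma comb_normE u : `|u| = comb_norm u. Proof. by []. Qed.

(** A Cauchy filter converges coordinatewise. The sum over a given comb involves
    finitely many coordinates, so Cauchy estimates pass to the limit for each
    comb, uniformly in the comb. *)
Lemma comb_space_complete (F : set_system comb_space) :
  ProperFilter F -> cauchy F -> cvg F.
Proof.
move=> FF /cauchyP Fc.
have near_diff e : 0 < e -> exists2 B : set comb_space, F B &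
    forall u v, B u -> B v -> comb_norm (u - v) <= e.
  move=> e0; have e2 : 0 < e / 2 by rewrite divr_gt0.
  have [w Fw] := Fc _ e2; exists (ball w (e / 2)) => // u v.
  rewrite -!ball_normE /= => uw vw; rewrite -comb_normE [leRHS]splitr.
  by rewrite (le_trans (ler_distD w _ _))// lerD// ?(ltW vw)// distrC ltW.
have Fg g : cvg ((fun u => u g : R) @ F).
  apply: R_complete; apply/cauchyP => e e0.
  have e2 : 0 < e / 2 by rewrite divr_gt0.
  have [B FB Be] := near_diff _ e2.
  have [w Bw] := filter_ex FB; exists (w g).
  suff : F [set u | ball (w g : R) e (u g)] by [].
  apply: filterS FB => u Bu; rewrite -ball_normE /=.
  have lt2 : e / 2 < e by rewrite ltr_pdivrMr// ltr_pMr// ltr1n.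
  apply: le_lt_trans lt2; apply: le_trans (Be _ _ Bw Bu).
  exact: (coef_le (w - u) g).
pose y g : R^o := lim ((fun u => u g : R) @ F).
have yB e B u : F B -> (forall u v, B u -> B v -> comb_norm (u - v) <= e) ->
    B u -> forall l, comb l -> \sum_(g <- l) `|u g - y g| <= e.
  move=> FB Be Bu l cl.
  have cv : (fun v : comb_space => \sum_(g <- l) `|u g - v g| : R) @ F -->
      (\sum_(g <- l) `|u g - y g| : R).
    apply: cvg_sum_seq => g; apply: cvg_norm; apply: cvgB; first exact: cvg_cst.
    exact: Fg.
  apply: (closed_cvg (fun r : R => r <= e) _ _ _ cv); first exact: closed_le.
  apply: filterS FB => v Bv; apply: le_trans (Be _ _ Bu Bv).
  exact: (comb_sum_le (u - v) cl).
have yP : y \in comb_null.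
  apply/comb_nullP => e e0.
  have e2 : 0 < e / 2 by rewrite divr_gt0.
  have [B FB Be] := near_diff _ e2; have [w Bw] := filter_ex FB.
  have /comb_nullP/(_ _ e2)[L wL] := coefP w.
  exists L => l cl.
  have yw := yB _ _ _ FB Be Bw l cl.
  apply: (@le_trans _ _ (\sum_(g <- l | g \notin L) (`|w g| + `|w g - y g|))).
    by apply: ler_sum => g _; have := ler_normB (w g) (w g - y g); rewrite subKr.
  rewrite big_split [leRHS]splitr lerD ?wL//=; apply: le_trans yw.
  rewrite big_mkcond ler_sum// => g _; by case: ifP.
apply/cvg_ex; exists (CombSpace yP); apply/cvgrPdist_le => e e0.
have [B FB Be] := near_diff _ e0.
apply: (filterS _ FB) => u Bu; rewrite distrC comb_normE.
by apply: comb_norm_le => [|l cl]; [exact: ltW|exact: (yB _ _ _ FB Be Bu l cl)].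
Qed.

HB.instance Definition _ := Uniform_isComplete.Build comb_space comb_space_complete.
End CombSpace.

(** * Duality in normed spaces *)

Section Dual.
Variables (R : realType) (X : normedModType R).
Implicit Types (f : dual X) (x : X).

Lemma dual_bounded f : exists2 C : R, 0 < C & forall x, `|f x| <= C * `|x|.
Proof.
have /linear_boundedP/pinfty_ex_gt0[C C0 fC] :=
  continuous_linear_bounded 0 (@dual_continuous _ _ f 0).
by exists C.
Qed.

Lemma bounded_dual (f : {linear X -> R^o}) (C : R) :
  (forall x, `|f x| <= C * `|x|) -> exists g : dual X, forall x, g x = f x.
Proof.
move=> fC; have fc : continuous f.
  apply: bounded_linear_continuous; apply/linear_boundedP.
  apply: filterS (nbhs_pinfty_ge (num_real C)) => r Cr x.
  by apply: le_trans (fC x) _; rewrite ler_wpM2r.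
by exists (Dual fc).
Qed.

Lemma dual_ext (f g : dual X) : (forall x, f x = g x) -> f = g.
Proof.
case: f g => [f fc] [g gc] /= fg.
have e : f = g.
  case: f g fg {fc gc} => [f [[fM] [fS]]] [g [[gM] [gS]]] /= /funext fg.
  by subst g; congr GRing.Linear.Pack; congr GRing.Linear.Class; congr (_ _);
    exact: Prop_irrelevance.
by subst g; congr Dual; exact: Prop_irrelevance.
Qed.

Lemma dual_ballP f : dual_ball f <-> forall x, `|f x| <= `|x|.
Proof.
have [C C0 fC] := dual_bounded f.
split=> [fB x|fB]; last first.
  apply: ge_sup => [|_ [x x1 <-]]; first by exists `|f 0|, 0 => //=; rewrite normr0.
  exact: le_trans (fB x) x1.
have [->|x0] := eqVneq x 0; first by rewrite linear0 !normr0.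
have nx : 0 < `|x| by rewrite normr_gt0.
have : `|f (`|x|^-1 *: x)| <= 1.
  apply: le_trans fB; apply: ub_le_sup.
    exists C => _ [y y1 <-]; apply: le_trans (fC y) _.
    by rewrite ler_piMr// ltW.
  by exists (`|x|^-1 *: x) => //=; rewrite normrZ normfV normr_id mulVf// gt_eqF.
rewrite linearZ normrZ normfV normr_id.
by rewrite mulrC ler_pdivrMr// mul1r.
Qed.

Lemma weak_continuous f : continuous (fun x : weak_space X => f x : R).
Proof.
move=> x; apply: (@continuous_comp _ _ _ (@weak_eval R X : weak_space X -> _)
  (fun u : {ptws dual X -> R} => u f)).
  exact: initial_continuous.
exact: proj_continuous.
Qed.

Lemma weak_star_continuous x : continuous (fun f : weak_star_dual X => f x : R).
Proof.
move=> f; apply: (@continuous_comp _ _ _ (@weak_star_eval R X : weak_star_dual X -> _)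
  (fun u : {ptws X -> R} => u x)).
  exact: initial_continuous.
exact: proj_continuous.
Qed.

Lemma ptws_continuous (S : topologicalType) (I : choiceType) (h : S -> {ptws I -> R}) :
  (forall i, continuous (fun s => h s i)) -> continuous h.
Proof.
move=> hc s; apply/cvg_sup => i; apply: continuous_comp_initial; exact: (hc i).
Qed.

(** The ball is the set of linear maps, a closed condition, inside the product of
    the intervals [[- |x|, |x|]], which is compact by Tychonoff. *)
Lemma alaoglu : compact ([set u | exists2 f, dual_ball f &
  u = weak_star_eval f] : set {ptws X -> R}).
Proof.
pose P : set {ptws X -> R} := [set u | forall x, `[- `|x|, `|x| : R]%classic (u x)].
have Pc : compact P.
  apply: (@tychonoff X (fun=> R) (fun x => `[- `|x|, `|x|]%classic)) => x.
  exact: segment_compact.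
pose L : set {ptws X -> R} := [set u | forall a x y, u (a *: x + y) = a * u x + u y].
have Lc : closed L.
  have pc (z : X) : continuous (fun u : {ptws X -> R} => u z).
    exact: proj_continuous.
  pose defect (axy : R * X * X) (u : {ptws X -> R}) : R :=
    u (axy.1.1 *: axy.1.2 + axy.2) - (axy.1.1 * u axy.1.2 + u axy.2).
  have defectc axy : continuous (defect axy).
    move=> u; rewrite /defect.
    exact: cvgB (pc _ u) (cvgD (cvgM (cvg_cst axy.1.1) (pc _ u)) (pc _ u)).
  have -> : L = \bigcap_(axy in [set: R * X * X]) (defect axy @^-1` [set 0]).
    apply/seteqP; split=> [u uL [[a x] y] _ /=|u uL a x y].
      by rewrite /defect uL subrr.
    by apply/eqP; rewrite -subr_eq0; apply/eqP; exact: (uL (a, x, y) I).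
  apply: closed_bigI => axy _.
  apply: ((continuous_closedP _).1 (defectc axy)); exact: closed_eq.
suff -> : [set u | exists2 f, dual_ball f & u = weak_star_eval f] = P `&` L.
  have Rh : hausdorff_space {ptws X -> R}.
    by apply: (@hausdorff_product X (fun=> R)) => x; exact: Rhausdorff.
  apply: (subclosed_compact _ Pc); last exact: subIsetl.
  by apply: closedI => //; exact: compact_closed Rh Pc.
apply/seteqP; split=> [_ [f /dual_ballP fB ->]|u [uP uL]].
  split=> [x|a x y] /=; last by rewrite /weak_star_eval linearP.
  by rewrite /weak_star_eval in_itv /= -ler_norml fB.
have ulin : linear (u : X -> R^o) by [].
pose ul := GRing.isLinear.Build _ _ _ _ (u : X -> R^o) ulin.
pose uL' : {linear X -> R^o} := HB.pack (u : X -> R^o) ul.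
have uB x : `|uL' x| <= `|x|.
  by have := uP x; rewrite /= in_itv /= -ler_norml.
have [f fu] : exists f : dual X, forall x, f x = uL' x.
  by apply: (@bounded_dual _ 1) => x; rewrite mul1r.
exists f; first by apply/dual_ballP => x; rewrite fu.
by apply/funext => x; rewrite /weak_star_eval fu.
Qed.

End Dual.

(** * Functionals on the comb space *)

Section CombSpaceDual.
Variables (R : realType) (A : choiceType).
Local Notation T := (nat -> A).
Local Notation X := (comb_space R A).
Implicit Types (g h : T) (u v : X) (l F : seq T).

Lemma basis_null g : (fun h => (h == g)%:R : R^o) \in @comb_null R A.
Proof.
apply/comb_nullP => e e0; exists [:: g] => l _.
by rewrite big1 ?ltW// => h; rewrite mem_seq1 => /negbTE->; rewrite normr0.
Qed.

Definition basis g : X := CombSpace (basis_null g).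

Definition finvec (a : T -> R) F : X := \sum_(g <- F) a g *: basis g.

Lemma finvecE a F g : uniq F -> finvec a F g = if g \in F then a g else 0.
Proof.
have sumE : finvec a F g = \sum_(h <- F) a h * (g == h)%:R.
  exact: (@big_morph _ _ (fun u : X => u g) 0 +%R 0 +%R (fun u v => coefD u v g) erefl).
rewrite sumE => uF; case: ifPn => [gF|gF].
  rewrite (bigD1_seq g)//= eqxx mulr1 big1 ?addr0// => h hg.
  by rewrite eq_sym (negbTE hg) mulr0.
rewrite big_seq big1// => h hF; case: eqP => [gh|_]; last by rewrite mulr0.
by move: gF; rewrite gh hF.
Qed.

Lemma finvec_approx u e : 0 < e ->
  exists F, `|u - finvec u F| <= e.
Proof.
move=> e0; have /comb_nullP/(_ _ e0)[F uF] := coefP u.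
exists (undup F).
rewrite comb_normE; apply: comb_norm_le => [|l cl]; first exact: ltW.
apply: le_trans (uF l cl); rewrite [leRHS]big_mkcond ler_sum// => g _.
rewrite coefB finvecE ?undup_uniq// mem_undup.
by case: ifP => _ /=; rewrite ?subrr ?normr0// subr0.
Qed.

Lemma dual_finvec (f : dual X) a F :
  f (finvec a F) = \sum_(g <- F) a g * f (basis g) :> R.
Proof.
rewrite /finvec linear_sum; apply: eq_bigr => g _; exact: linearZ.
Qed.

(** If [|f|] is at least [1 / k.+1] at each vector [basis g] with [g] in a finite
    set [F], then the sum of these vectors, with the right signs, has norm at
    least [size F / (C * k.+1)], where [C] bounds [f]. Its coordinates have
    modulus [1] on [F], so its norm is the size of a largest comb contained in
    [F]. Hence these [g] form a comb-rich set. *)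
Lemma dual_support_countable (f : dual X) :
  countable [set g | (f (basis g) : R) != 0].
Proof.
have [C C0 fC] := dual_bounded f.
pose G k := [set g | k.+1%:R^-1 <= `|f (basis g) : R|].
apply: (@sub_countable _ _ _ (\bigcup_k G k)).
  apply: subset_card_le => g /= fg.
  have fg0 : 0 < `|f (basis g) : R| by rewrite normr_gt0.
  have /ltr_add_invr[k] := fg0; rewrite add0r => /ltW kg; by exists k.
apply: bigcup_countable => // k _.
have [->|/set0P[g0 _]] := eqVneq (G k) set0; first exact: countable0.
pose q := (Num.bound (C * k.+1%:R)).+1.
have qC : C * k.+1%:R < q%:R.
  rewrite (lt_trans (archi_boundP _))// ?ltr_nat// mulr_ge0// ltW//.
apply: (@comb_rich_countable A q) => F uF FG.
apply: contrapT => poor.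
have small l : comb l -> {subset l <= F} -> (q * size l < size F)%N.
  move=> cl lF; rewrite ltnNge; apply/negP => rich; apply: poor.
  by exists l.
have F0 : (0 < size F)%N.
  have cnil : @comb A [::] by exact: comb_sub (comb1 g0).
  by have := small [::] cnil; rewrite muln0; apply.
pose u := finvec (fun g => Num.sg (f (basis g) : R)) F.
have uE g : `|u g| <= (g \in F)%:R.
  by rewrite finvecE//; case: ifP => _; rewrite ?normr0// normr_sg lern1 leq_b1.
have un : q%:R * `|u| <= (size F).-1%:R.
  rewrite -ler_pdivlMl ?ltr0n// comb_normE; apply: comb_norm_le => [|l cl].
    by rewrite mulr_ge0// invr_ge0.
  rewrite ler_pdivlMl ?ltr0n//.
  pose l' := [seq g <- l | g \in F].
  have cl' : comb l'.
    apply: (comb_sub _ _ cl); first by rewrite filter_uniq//; case: cl.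
    exact: mem_subseq (filter_subseq _ _).
  have l'F : {subset l' <= F} by move=> g; rewrite mem_filter => /andP[].
  have sumle : \sum_(g <- l) `|u g| <= (size l')%:R.
    rewrite size_filter -sum1_count natr_sum [leRHS]big_mkcond/=.
    by rewrite ler_sum// => g _; rewrite (le_trans (uE g))//; case: ifP.
  rewrite (le_trans (ler_wpM2l _ sumle))// -natrM ler_nat.
  by rewrite -ltnS prednK// small.
have fu : (size F)%:R / k.+1%:R <= f u :> R.
  rewrite dual_finvec -[X in X%:R](@count_predT _ F) -sum1_count natr_sum mulr_suml.
  rewrite big_seq [leRHS]big_seq ler_sum// => g gF; rewrite mul1r.
  by rewrite -normrEsg; have := FG g gF; rewrite inE.
have := le_trans fu (le_trans (ler_norm _) (fC u)).
rewrite ler_pdivrMr// mulrAC leNgt => /negP; apply.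
apply: (@le_lt_trans _ _ (q%:R * `|u|)).
  by rewrite ler_wpM2r// ltW.
by rewrite (le_lt_trans un)// ltr_nat prednK.
Qed.

End CombSpaceDual.

(** * The comb space is weakly Lindelof determined *)

Section WLD.
Variables (R : realType) (A : choiceType).
Local Notation T := (nat -> A).
Local Notation X := (comb_space R A).

Definition basis_values (f : dual X) : {ptws T -> R} := fun g => f (basis R g).

Lemma dual_ball_approx (f : dual X) (u v : X) e : dual_ball f -> `|u - v| <= e ->
  `|(f u : R) - f v| <= e.
Proof.
by move=> /dual_ballP fB; apply: le_trans; rewrite -linearB; exact: fB.
Qed.

Lemma basis_values_inj (f h : dual X) : dual_ball f -> dual_ball h ->
  basis_values f = basis_values h -> f = h.
Proof.
move=> fB hB fh; apply: dual_ext => u.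
apply/eqP; rewrite -subr_eq0 -normr_le0; apply/ler_addgt0Pl => e e0.
rewrite addr0; have e2 : 0 < e / 2 by rewrite divr_gt0.
have [F uFe] := finvec_approx u e2.
have := lerD (dual_ball_approx fB uFe) (dual_ball_approx hB uFe).
rewrite -splitr; apply: le_trans.
have -> : (f (finvec u F) : R) = h (finvec u F).
  rewrite !dual_finvec; apply: eq_bigr => g _.
  by have /(congr1 (fun w => w g)) := fh; rewrite /basis_values => ->.
by rewrite (distrC (h u : R)) ler_distD.
Qed.

Definition basis_image : set {ptws T -> R} :=
  [set w | exists2 f : dual X, dual_ball f & w = basis_values f].

Lemma basis_image_compact : compact basis_image.
Proof.
pose r (u : {ptws X -> R}) : {ptws T -> R} := fun g => u (basis R g).
have rc : continuous r.
  apply: ptws_continuous => g.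
  exact: (@proj_continuous X (fun=> R) (basis R g)).
suff -> : basis_image = r @` [set u | exists2 f : dual X, dual_ball f &
    u = weak_star_eval f].
  apply: continuous_compact; last exact: alaoglu.
  exact: continuous_subspaceT.
apply/seteqP; split=> [_ [f fB ->]|_ [_ [f fB ->] <-]]; last by exists f.
by exists (weak_star_eval f) => //; exists f.
Qed.

(** Evaluation on the basis vectors is a homeomorphism from the dual ball onto
    [basis_image]. For the continuity of its inverse, [u] is approximated in norm
    by a finite combination of basis vectors: this approximates all the
    functionals of the ball at [u], uniformly. *)
Lemma comb_space_wld : weakly_Lindelof_determined X.
Proof.
exists T, basis_image; split; first exact: basis_image_compact.
  by move=> _ [f fB ->]; exact: dual_support_countable.
pose ball := set_type (@dual_ball R X).
have ballP (f : ball) : dual_ball (val f) by exact: set_mem (valP f).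
pose phi (f : ball) : set_type basis_image :=
  SigSub (mem_set (ex_intro2 _ _ (val f) (ballP f) erefl)).
have psiP (w : set_type basis_image) : exists f : ball, basis_values (val f) = val w.
  have [f fB wf] := set_mem (valP w).
  by exists (SigSub (mem_set fB)); rewrite wf.
pose psi w := sval (cid (psiP w)).
have psiE w : basis_values (val (psi w)) = val w by exact: svalP (cid (psiP w)).
exists phi, psi; split.
- move=> f; apply: val_inj.
  exact: basis_values_inj (ballP _) (ballP _) (psiE (phi f)).
- by move=> w; apply: val_inj; exact: (psiE w).
- apply: continuous_comp_initial; apply: ptws_continuous => g f.
  apply: (@continuous_comp _ _ _ (val : ball -> weak_star_dual X)
    (fun f : weak_star_dual X => f (basis R g) : R)).
    exact: initial_continuous.
  exact: weak_star_continuous.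
apply: continuous_comp_initial; apply: continuous_comp_initial.
apply: ptws_continuous => u w; apply/(@cvgrPdist_le _ _ _ _ (nbhs_filter w)) => e e0.
have e3 : 0 < e / 3 by rewrite divr_gt0.
have [F uFe] := finvec_approx u e3.
have gc g : continuous (fun z : set_type basis_image => val z g : R).
  move=> z; apply: (@continuous_comp _ _ _
    (val : set_type basis_image -> {ptws T -> R}) (fun w : {ptws T -> R} => w g)).
    exact: initial_continuous.
  exact: proj_continuous.
have sumc : continuous (fun z : set_type basis_image =>
    \sum_(g <- F) u g * val z g : R).
  move=> z; apply: (@cvg_sum_seq _ _ _ _ (nbhs_filter z)) => g.
  exact: (@cvgM _ _ _ (nbhs_filter z) _ _ _ _ (cvg_cst (u g : R)) (gc g z)).
have near_val (z : set_type basis_image) :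
    `|(val (psi z) u : R) - \sum_(g <- F) u g * val z g| <= e / 3.
  have := dual_ball_approx (ballP (psi z)) uFe.
  rewrite dual_finvec; congr (`|_ - _| <= _); apply: eq_bigr => g _.
  by congr (_ * _); exact: (congr1 (fun w : {ptws T -> R} => w g) (psiE z)).
move/(@cvgrPdist_le _ _ _ _ (nbhs_filter w)) : (sumc w) => /(_ _ e3).
apply: (@filterS _ _ (nbhs_filter w)) => z wz.
pose S (z : set_type basis_image) : R := \sum_(g <- F) u g * val z g.
pose V (z : set_type basis_image) : R := val (psi z) u.
have := (near_val w, near_val z, wz); rewrite -/(S w) -/(S z) -/(V w) -/(V z).
move=> [[wS zS] wzS]; suff : `|V w - V z| <= e by [].
have := ler_distD (S w) (V w) (V z); have := ler_distD (S z) (S w) (V z).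
rewrite (distrC (S z) (V z)); lra.
Qed.

End WLD.

(** * Weakly compact sets and infinite combs *)

Lemma compact_subseq_cluster (S : topologicalType) (K : set S) (x : nat -> S) :
  compact K -> (forall n, K (x n)) ->
  exists2 y, K y & forall N B, nbhs y B -> exists2 n, (N <= n)%N & B (x n).
Proof.
move=> Kc xK; have [y [Ky ycl]] : K `&` cluster (x @ \oo) !=set0.
  by apply: Kc; exists 0%N => // n _; exact: xK.
exists y => // N B yB.
have [|_ [[n Nn <-] Bn]] := ycl [set x n | n in [set n | (N <= n)%N]] B _ yB.
  by exists N => // n /= Nn; exists n.
by exists n.
Qed.

Section CombSequences.
Variables (R : realType) (A : choiceType).
Local Notation T := (nat -> A).
Local Notation X := (comb_space R A).
Implicit Types (g h : T) (u v : X) (d : nat -> T).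

Definition comb_seq d := forall s : seq nat, uniq s -> comb (map d s).

Lemma comb_seq_inj d : comb_seq d -> injective d.
Proof.
move=> dc m n dmn; apply: contrapT => /eqP mn.
have [] := dc [:: m; n]; first by rewrite /= mem_seq1 mn.
by rewrite /= dmn mem_seq1 eqxx.
Qed.

Lemma comb_seq_comp d (p : nat -> nat) : injective p -> comb_seq d ->
  comb_seq (d \o p).
Proof.
move=> pinj dc s us; rewrite map_comp; apply: dc.
by rewrite map_inj_uniq.
Qed.

Lemma comb_seq_sum d u s : comb_seq d -> uniq s ->
  \sum_(k <- s) `|u (d k)| <= `|u|.
Proof.
move=> dc us; rewrite -(big_map d xpredT (fun g => `|u g|)).
exact/comb_sum_le/dc.
Qed.

Lemma comb_seq_tail d u e : comb_seq d -> 0 < e -> exists M, forall s : seq nat,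
  uniq s -> {in s, forall k, (M <= k)%N} -> \sum_(k <- s) `|u (d k)| <= e.
Proof.
move=> dc e0; have /comb_nullP/(_ _ e0)[F uF] := coefP u.
have [M MF] : exists M, forall k, (M <= k)%N -> d k \notin F.
  elim: F {uF} => [|g F [M MF]]; first by exists 0%N.
  have [[k dk]|nk] := pselect (exists k, d k = g); last first.
    exists M => k Mk; rewrite in_cons negb_or MF// andbT.
    by apply/eqP => dk; apply: nk; exists k.
  exists (maxn M k.+1) => j; rewrite geq_max => /andP[Mj kj].
  rewrite in_cons negb_or MF// andbT -dk; apply/eqP => /(comb_seq_inj dc) jk.
  by rewrite jk ltnn in kj.
exists M => s us sM; apply: le_trans (uF _ (dc _ us)).
rewrite big_map [leRHS]big_mkcond/= big_seq [leRHS]big_seq ler_sum// => k /sM/MF.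
by move=> ->.
Qed.

Lemma coef_dual g : exists f : dual X, forall u, f u = u g.
Proof.
have cl : linear (fun u : X => u g : R^o) by [].
pose cL := GRing.isLinear.Build _ _ _ _ (fun u : X => u g : R^o) cl.
pose c : {linear X -> R^o} := HB.pack (fun u : X => u g : R^o) cL.
have [|f fE] := @bounded_dual _ _ c 1; last by exists f.
by move=> u; rewrite mul1r; exact: coef_le.
Qed.

Lemma weak_coef_continuous g : continuous (fun u : weak_space X => (u : X) g : R).
Proof.
have [f fE] := coef_dual g.
have -> : (fun u : weak_space X => (u : X) g : R) = (fun u => f u).
  by apply/funext => u; rewrite fE.
exact: weak_continuous.
Qed.

(** Summation along an infinite comb is a functional of norm at most [1]: the
    comb norm dominates the [l^1] norm on the comb. *)
Lemma comb_seq_dual d : comb_seq d -> exists f : dual X, forall u,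
  (fun n => \sum_(0 <= k < n) u (d k) : R) @ \oo --> (f u : R).
Proof.
move=> dc.
have sumc u : cvgn (series (fun k => u (d k) : R)).
  apply: normed_cvg; apply: nondecreasing_is_cvgn.
    by apply: nondecreasing_series => k _ _; exact: normr_ge0.
  exists `|u| => _ [n _ <-]; rewrite /series /=.
  by apply: comb_seq_sum => //; exact: iota_uniq.
pose s u : R^o := limn (series (fun k => u (d k) : R)).
have sl : linear s.
  move=> a u v; apply: cvg_lim => //.
  have -> : series (fun k => (a *: u + v) (d k) : R) =
      (fun n => a * series (fun k => u (d k) : R) n + series (fun k => v (d k) : R) n).
    apply/funext => n; rewrite /series /= mulr_sumr -big_split.
    by apply: eq_bigr.
  exact: cvgD (cvgM (cvg_cst a) (sumc u)) (sumc v).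
pose sL := GRing.isLinear.Build _ _ _ _ s sl.
pose sf : {linear X -> R^o} := HB.pack s sL.
have [u|f fE] := @bounded_dual _ _ sf 1; last first.
  by exists f => u; rewrite fE; exact: sumc.
rewrite mul1r.
apply: (closed_cvg (fun r : R => r <= `|u|) _ _ _ (cvg_norm (sumc u))).
  exact: closed_le.
apply: nearW => n; rewrite /series /=.
by apply: le_trans (ler_norm_sum _ _ _) _; apply: comb_seq_sum => //; exact: iota_uniq.
Qed.

(** A gliding hump argument, as for the Schur property of [l^1]. Pass to a
    subsequence [z n = x (p n)], [c n = d (p n)] such that the coordinates of
    [z n] along [c] have absolute sum at most [1/4] before the [n]-th one and at
    most [1/8] after it. Then summation along [c] from level [M] on takes values
    at least [1/2 - 1/4 - 1/8 = 1/8] at [z n] for all [n >= M], hence also at any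
    weak cluster point [w] of [z]. But at [w] it tends to [0] as [M] grows. *)
Lemma weakly_compact_comb_seq (K : set (weak_space X)) d (x : nat -> X) :
  compact K -> comb_seq d -> (forall n, K (x n)) ->
  ~ (forall n, 2^-1 <= (x n : X) (d n)).
Proof.
move=> Kc dc xK xd.
(* Finitely many coordinates of [x n] are infinitely often close to those of the
   cluster point [y], and those of index at least [M0] are small for [y]. This
   is how the coordinates of [z n] before the [n]-th one are made small. *)
have [y Ky ycl] := compact_subseq_cluster Kc xK.
have e8 : 0 < 8^-1 :> R by rewrite invr_gt0.
have [M0 yM] := comb_seq_tail (y : X) dc e8.
have /choice[tail tailP] : forall n, exists M, forall s : seq nat,
    uniq s -> {in s, forall k, (M <= k)%N} -> \sum_(k <- s) `|x n (d k)| <= 8^-1.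
  by move=> n; exact: comb_seq_tail.
have /choice[next nextP] : forall s : seq nat, exists n,
    [/\ (M0 <= n)%N, {in s, forall k, (k < n)%N /\ (tail k <= n)%N} &
      uniq s -> {in s, forall k, (M0 <= k)%N} ->
      \sum_(k <- s) `|x n (d k)| <= 4^-1].
  move=> s; pose N := (M0 + \sum_(k <- s) (k.+1 + tail k))%N.
  pose D (z : weak_space X) : R := \sum_(k <- s) `|(z : X) (d k) - (y : X) (d k)|.
  have Dc : continuous D.
    move=> z; apply: (@cvg_sum_seq _ _ _ _ (nbhs_filter z)) => k.
    apply: (@cvg_norm _ _ _ _ (nbhs_filter z)).
    exact: (@cvgB _ _ _ _ (nbhs_filter z) _ _ _ _ (@weak_coef_continuous (d k) z)
      (cvg_cst ((y : X) (d k) : R))).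
  have Dy : nbhs y [set z | D z < 8^-1].
    apply: (Dc y [set r | r < 8^-1]); apply: open_nbhs_nbhs; split=> /=.
      exact: open_lt.
    by rewrite /D big1// => k _; rewrite subrr normr0.
  have [n Nn /= Dn] := ycl N _ Dy.
  exists n; split=> [|k ks|us sM].
  - by apply: leq_trans Nn; exact: leq_addr.
  - have : (k.+1 + tail k <= n)%N.
      apply: leq_trans Nn; apply: leq_trans (leq_addl _ _).
      by rewrite (big_rem k)//= leq_addr.
    by lia.
  - have := lerD (ltW Dn) (yM s us sM).
    have -> : 8^-1 + 8^-1 = 4^-1 :> R by lra.
    apply: le_trans; rewrite /D -big_split ler_sum// => k _.
    by have := ler_normD (x n (d k) - (y : X) (d k)) ((y : X) (d k)); rewrite subrK.
pose hist := fix hist n := if n is m.+1 then next (hist m) :: hist m else [::].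
pose p n := next (hist n).
have histE n : hist n = map p (rev (iota 0 n)).
  by elim: n => [//|n IH]; rewrite -addn1 iotaD rev_cat /= -IH add0n addn1.
have hist_mem j n : (j < n)%N -> p j \in hist n.
  by move=> jn; rewrite histE map_f// mem_rev mem_iota.
have p_lt j n : (j < n)%N -> (p j < p n)%N /\ (tail (p j) <= p n)%N.
  by move=> /hist_mem; have [_ + _] := nextP (hist n); exact.
have p_inj : injective p.
  by move=> m n pmn; case: (ltngtP m n) => // /p_lt[]; rewrite pmn ltnn.
have head n : \sum_(0 <= j < n) `|x (p n) (d (p j))| <= 4^-1.
  have hu : uniq (hist n) by rewrite histE map_inj_uniq// rev_uniq iota_uniq.
  have hM : {in hist n, forall k, (M0 <= k)%N}.
    by move=> k; rewrite histE => /mapP[j _ ->]; case: (nextP (hist j)).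
  have [_ _ /(_ hu hM)] := nextP (hist n); apply: le_trans.
  rewrite -/(p n) histE big_map /index_iota subn0.
  by have /permPl/(perm_big _)-> := perm_rev (iota 0 n).
have rest n N : \sum_(n.+1 <= j < N) `|x (p n) (d (p j))| <= 8^-1.
  rewrite -(big_map p xpredT (fun k => `|x (p n) (d k)|)).
  apply: tailP; first by rewrite map_inj_uniq// iota_uniq.
  by move=> _ /mapP[j + ->]; rewrite mem_index_iota => /andP[/p_lt[]].
pose z n : weak_space X := x (p n); pose c := d \o p.
have cc : comb_seq c by exact: comb_seq_comp.
have [w Kw wcl] := compact_subseq_cluster Kc (fun n => xK (p n) : K (z n)).
(* Any bound below [1/8] would do instead of [1/16]. *)
have [M wM] := comb_seq_tail (w : X) cc (e := 16^-1) ltac:(by rewrite invr_gt0).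
have shiftc : comb_seq (fun j => c (M + j)%N).
  by apply: (comb_seq_comp (p := addn M)) cc; exact: addnI.
have [f fP] := comb_seq_dual shiftc.
have fw : (f w : R) <= 16^-1.
  apply: (closed_cvg (fun r : R => r <= 16^-1) _ _ _ (fP w)); first exact: closed_le.
  apply: nearW => n; apply: le_trans (ler_norm _) _.
  apply: le_trans (ler_norm_sum _ _ _) _.
  rewrite -(big_map (addn M) xpredT (fun k => `|(w : X) (c k)|)).
  apply: wM; first by rewrite map_inj_uniq ?iota_uniq//; exact: addnI.
  by move=> _ /mapP[j _ ->]; exact: leq_addr.
have fz n : (M <= n)%N -> 8^-1 <= (f (z n) : R).
  move=> Mn; apply: (closed_cvg (fun r : R => 8^-1 <= r) _ _ _ (fP (z n))).
    exact: closed_ge.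
  exists n.+1 => // N /= nN.
  have -> : \sum_(0 <= k < N) (z n : X) (c (M + k)%N) =
      \sum_(M <= j < n) (z n : X) (c j) + (z n : X) (c n) +
      \sum_(n.+1 <= j < M + N) (z n : X) (c j) :> R.
    rewrite -big_nat_recr//= -big_cat_nat//=; [|lia..].
    rewrite -[in RHS](addn0 M) [in RHS](addnC M 0%N) big_addn addKn.
    by apply: eq_bigr => j _; rewrite addnC.
  have lo : `|\sum_(M <= j < n) (z n : X) (c j) : R| <= 4^-1.
    apply: le_trans (ler_norm_sum _ _ _) _; apply: le_trans (head n).
    by rewrite [leRHS](@big_cat_nat _ _ _ M)//= lerDr sumr_ge0.
  have hi : `|\sum_(n.+1 <= j < M + N) (z n : X) (c j) : R| <= 8^-1.
    by apply: le_trans (ler_norm_sum _ _ _) _; exact: rest.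
  have := xd (p n); rewrite -/(z n) -/(c n).
  move: lo hi; rewrite !ler_norml => /andP[lo _] /andP[hi _] zn.
  have -> : 8^-1 = - 4^-1 + 2^-1 - 8^-1 :> R by lra.
  by rewrite !lerD.
have fc : nbhs w [set v : weak_space X | (f v : R) < 8^-1].
  apply: (@weak_continuous _ _ f w [set r | r < 8^-1]).
  apply: open_nbhs_nbhs; split=> /=; first exact: open_lt.
  by apply: le_lt_trans fw _; lra.
have [n Mn /= /(le_lt_trans (fz n Mn))] := wcl M _ fc.
by rewrite ltxx.
Qed.

End CombSequences.

(** * The comb space over a power set *)

Lemma cantor_diagonal (I : Type) (h : I -> set I) :
  exists a : set I, forall i, h i <> a.
Proof.
exists [set i | ~ h i i] => i hi.
have e : h i i = ~ h i i by rewrite [in LHS]hi.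
have n : ~ h i i by move=> hii; move: (hii); rewrite e.
by apply: (n); rewrite e.
Qed.

(** Colour [g] by the index of a compact set containing a vector whose coordinate
    at [g] is at least [1/2]; weak density provides one near [basis g]. A
    monochromatic infinite comb contradicts [weakly_compact_comb_seq]. *)
Lemma comb_space_not_generated (R : realType) (I : Type) :
  ~ compactly_generated_by (weak_space (comb_space R (set I))) I.
Proof.
move=> [K [Kc Kd]]; set X := comb_space R (set I).
have /choice[c cP] : forall g : nat -> set I, exists i, exists2 x : X,
    K i x & 2^-1 <= x g.
  move=> g; have [||x [/= gx [i _ Kx]]] :=
      Kd [set x : weak_space X | 2^-1 < (x : X) g].
  - by exists (basis R g) => /=; rewrite eqxx mulr1n invf_lt1 ?ltr1n.
  - have /continuousP/(_ _ (@open_gt R 2^-1)) := @weak_coef_continuous R _ g.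
    by [].
  - by exists i, x => //; exact: ltW.
have [i [d [_ di dc]]] := monochromatic_comb c set0 (@cantor_diagonal I).
have /choice[x xP] : forall n, exists x : X, K i x /\ 2^-1 <= x (d n).
  by move=> n; have [x] := cP (d n); rewrite di; exists x.
apply: (weakly_compact_comb_seq (Kc i) dc (x := x)) => n.
  by case: (xP n).
by case: (xP n).
Qed.

Theorem theorem2 (R : realType) (kappa : Type) :
  exists X : completeNormedModType R,
    weakly_Lindelof_determined X /\
    exists C : Type, is_CG (weak_space X) C /\ card_lt [set: kappa] [set: C].
Proof.
exists (comb_space R (set kappa)); split; first exact: comb_space_wld.
have [C CG] := is_CG_exists (weak_space (comb_space R (set kappa))).
exists C; split=> //.
have Ck : ~ ([set: C] #<= [set: kappa]).
  case: CG => _ gen _ /compactly_generated_by_inj/(_ gen).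
  exact: comb_space_not_generated.
by split=> //; case: (card_le_total kappa C).
Qed.
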